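(* Let $n\ge 4$ and let $\tau_0,\tau_1,\dots,\tau_n$ be distinct real nodes whose mesh widths $h_k=\tau_k-\tau_{k-1}$, $1\le k\le n$, all have the same sign. Let $\mathbf{A}$ be the $(n+1)\times(n+1)$ tridiagonal matrix of the compact finite difference formula with the fourth-order compact formulas at the edges (entries given in the context). Then $\mathbf{A}$ is totally nonnegative, that is, all minors of $\mathbf{A}$ (determinants of square submatrices) are nonnegative. Moreover, all principal minors of $\mathbf{A}$ are strictly positive, so $\mathbf{A}$ is positive definite.
   Context: Index the rows and columns of $\mathbf{A}$ by $0,1,\dots,n$. The matrix $\mathbf{A}=(A_{i,j})$ is tridiagonal (all entries not listed are zero) with: first row: $A_{0,0}=\dfrac{h_2(h_2+h_3)}{(h_1+h_2)(h_1+h_2+h_3)}$, $A_{0,1}=1$; interior rows, for $1\le k\le n-1$: $A_{k,k-1}=\dfrac{4h_{k+1}^2}{(h_k+h_{k+1})^2}$, $A_{k,k}=4$, $A_{k,k+1}=\dfrac{4h_k^2}{(h_k+h_{k+1})^2}$; last row: $A_{n,n-1}=1$, $A_{n,n}=\dfrac{h_{n-1}(h_{n-2}+h_{n-1})}{(h_{n-1}+h_n)(h_{n-2}+h_{n-1}+h_n)}$. This is the coefficient matrix, acting on the vector of unknown derivatives $f'(\tau_0),\dots,f'(\tau_n)$, of the fourth-order compact finite difference equations: interior row $k$ relates the derivatives at $\tau_{k-1},\tau_k,\tau_{k+1}$ to the function values there, and the first (last) row relates the derivatives at the two leftmost (rightmost) nodes to the function values at the four leftmost (rightmost) nodes. A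 principal minor is the determinant of a submatrix with the same nonempty set of row and column indices.
   Formalization: ''Positive definite'' is read as: some positive diagonal matrix D makes DA symmetric positive definite; the usual condition x^T A x > 0 for all nonzero x fails for the nonsymmetric A, e.g. n = 4, mesh widths 10, 1, 1, 1, x = (-8, 1, 0, 0, 0). *)

(* Defs.v *)
From HB Require Import structures.
From mathcomp Require Import all_boot all_order all_algebra.
From mathcomp Require Import ring lra.

Set Implicit Arguments.
Unset Strict Implicit.
Unset Printing Implicit Defensive.

Import Order.TTheory GRing.Theory Num.Theory.
Local Open Scope ring_scope.

(* h_k = tau_k - tau_(k-1); meaningful for 1 <= k <= n only. *)
Definition mesh (R : realFieldType) (n : nat) (tau : 'I_n.+1 -> R) (k : nat) : R :=
  tau (inord k) - tau (inord k.-1).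

Definition same_sign_mesh (R : realFieldType) (n : nat) (h : nat -> R) : Prop :=
  (forall k, (1 <= k <= n)%N -> 0 < h k) \/
  (forall k, (1 <= k <= n)%N -> h k < 0).

Definition compact_entry (R : realFieldType) (n : nat) (h : nat -> R)
    (i j : nat) : R :=
  if i == 0%N then
    if j == 0%N then
      (h 2 * (h 2 + h 3)) / ((h 1 + h 2) * (h 1 + h 2 + h 3))
    else if j == 1%N then 1 else 0
  else if i == n then
    if j == n.-1 then 1
    else if j == n then
      (h n.-1 * (h n.-2 + h n.-1)) /
        ((h n.-1 + h n) * (h n.-2 + h n.-1 + h n))
    else 0
  else
    if j == i.-1 then (4 * h i.+1 ^+ 2) / (h i + h i.+1) ^+ 2
    else if j == i then 4
    else if j == i.+1 then (4 * h i ^+ 2) / (h i + h i.+1) ^+ 2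
    else 0.

Definition compact_mx (R : realFieldType) (n : nat) (tau : 'I_n.+1 -> R) :
    'M[R]_n.+1 :=
  \matrix_(i, j) compact_entry n (mesh tau) i j.

(* An m-element set of indices is given by its increasing enumeration
   'I_m -> 'I_n; repetitions and reorderings are excluded. *)
Definition increasing (m n : nat) (f : 'I_m -> 'I_n) : Prop :=
  forall i j : 'I_m, (i < j)%N -> (f i < f j)%N.

Definition totally_nonneg (R : realFieldType) (n : nat) (A : 'M[R]_n) : Prop :=
  forall (m : nat) (f g : 'I_m -> 'I_n), (0 < m)%N ->
    increasing f -> increasing g -> 0 <= \det (mxsub f g A).

Definition principal_minors_pos (R : realFieldType) (n : nat) (A : 'M[R]_n) : Prop :=
  forall (m : nat) (f : 'I_m -> 'I_n), (0 < m)%N ->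
    increasing f -> 0 < \det (mxsub f f A).

Definition symmetric_posdef (R : realFieldType) (n : nat) (S : 'M[R]_n) : Prop :=
  S^T = S /\ forall x : 'cV[R]_n, x != 0 -> 0 < (x^T *m S *m x) 0 0.

(* Positive definiteness of a matrix that need not be symmetric: A is
   self-adjoint and positive definite for the inner product
   <x, y> = \sum_i d_i x_i y_i with positive weights d_i.  Over the
   reals this says that D^(1/2) A D^(-1/2), which has the same principal minors
   and eigenvalues as A, is symmetric positive definite; this is the sense in which positivity of
   the principal minors yields definiteness (Sylvester's criterion).
   For d = 1 it is the usual notion for symmetric matrices.  The condition
   0 < x^T A x for all x != 0 is not suitable here: it fails for some of the
   matrices compact_mx, see compact_mx_form_neg. *)
Definition posdef (R : realFieldType) (n : nat) (A : 'M[R]_n) : Prop :=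
  exists d : 'rV[R]_n,
    (forall i, 0 < d 0 i) /\ symmetric_posdef (diag_mx d *m A).

(* Mesh widths 10, 1, 1, 1. *)
Lemma compact_mx_form_neg (R : realFieldType) :
  let tau : 'I_5 -> R := fun i => if i == 0 :> nat then 0 else (9 + i)%:R in
  injective tau /\ same_sign_mesh 4 (mesh tau) /\
  exists x : 'cV[R]_5, (x^T *m compact_mx tau *m x) 0 0 < 0.
Proof.
move=> tau.
have h1 : mesh tau 1 = 10 by rewrite /mesh /tau !inordK //= subr0.
have h2 k : (2 <= k <= 4)%N -> mesh tau k = 1.
  case: k => [|[|[|[|[|k]]]]] //= _; rewrite /mesh /tau !inordK //=;
    by rewrite -natrB // subnDl.
split; last split.
- move=> i j; rewrite /tau => e; apply: val_inj => /=.
  move: e; case: (nat_of_ord i) => [|a]; case: (nat_of_ord j) => [|b] //=.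
  + by move/eqP; rewrite eq_sym pnatr_eq0.
  + by move/eqP; rewrite pnatr_eq0.
  + by move/eqP; rewrite eqr_nat eqn_add2l => /eqP.
- left=> -[|[|k]] // hk; first by rewrite h1.
  by rewrite h2.
exists (\col_i (if i == 0 :> nat then -8 else if i == 1 :> nat then 1 else 0)).
rewrite !mxE !big_ord_recl big_ord0 !mxE !big_ord_recl !big_ord0 !mxE /=.
rewrite /compact_entry /= !h1 !h2 //.
have e0 : 1 * (1 + 1) / ((10 + 1) * (10 + 1 + 1)) = 1 / 66 :> R.
  by field; rewrite ?pnatr_eq0 //; lra.
have e1 : 4 * 1 ^+ 2 / (10 + 1) ^+ 2 = 4 / 121 :> R.
  by field; rewrite ?pnatr_eq0 //; lra.
rewrite e0 e1 !(mul0r, mulr0, addr0, add0r); lra.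
Qed.

(* Main.v *)
(* A nonnegative tridiagonal matrix A is handled through lower bounds p_k > 0 for
   the pivots of an elimination run from the last row to the first:
   p_n <= A_(n,n) and p_k + A_(k,k+1) A_(k+1,k) / p_(k+1) <= A_(k,k).
   Expanding a minor along its first row shows that it is nonnegative, and that it
   is at least p_i times the smaller minor when its first row and column are both
   i; principal minors are therefore at least products of p's.  Rescaling the rows
   makes A symmetric, and completing squares gives definiteness.

   For the compact scheme put
   g_k = 4 h_(k-1) h_(k+1) / ((h_(k-1) + h_k) (h_k + h_(k+1))).
   Then A_(k,k+1) A_(k+1,k) = g_(k+1)^2 between interior rows, g_k + g_(k+1) < 4,
   and the edge rows satisfy g_(n-1) + A_(n-1,n) / A_(n,n) = 4 and
   A_(0,0) (4 - g_2) = A_(1,0).  Hence p_n = A_(n,n), p_k = g_k for 3 <= k < n,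
   p_2 = 4 - g_3 > g_2, p_1 = 4 - g_2^2 / p_2 > 4 - g_2 and
   p_0 = A_(0,0) - A_(1,0) / p_1 > 0 are admissible; n >= 4 is what leaves room for
   the strict gain at p_2. *)
Require Import Defs.
From HB Require Import structures.
From mathcomp Require Import all_boot all_order all_algebra.
From mathcomp Require Import ring lra zify.
Import Order.TTheory GRing.Theory Num.Theory.
Local Open Scope ring_scope.

(** * Pivot bounds for a tridiagonal matrix *)

(** Lower bounds instead of the exact pivots: the exact recursion need not have a closed form, while
    bounds in closed form are enough for every sign argument. *)
Record pivots {R : realFieldType} (n : nat) (a : nat -> nat -> R)
    (p : nat -> R) : Prop := {
  pivots_tridiag : forall i j, (i.+1 < j)%N || (j.+1 < i)%N -> a i j = 0;
  pivots_upper : forall i, (i < n)%N -> 0 < a i i.+1;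
  pivots_lower : forall i, (i < n)%N -> 0 < a i.+1 i;
  pivots_gt0 : forall i, (i <= n)%N -> 0 < p i;
  pivots_last : p n <= a n n;
  pivots_step : forall i, (i < n)%N ->
    p i + a i i.+1 * a i.+1 i / p i.+1 <= a i i
}.

Arguments pivots_tridiag {R n a p}.
Arguments pivots_upper {R n a p} _ [i].
Arguments pivots_lower {R n a p} _ [i].
Arguments pivots_gt0 {R n a p} _ [i].
Arguments pivots_last {R n a p}.
Arguments pivots_step {R n a p} _ [i].

Lemma pivots_le_diag {R : realFieldType} {n : nat} {a : nat -> nat -> R}
    {p : nat -> R} [i : nat] :
  pivots n a p -> (i <= n)%N -> p i <= a i i.
Proof.
move=> P; rewrite leq_eqVlt => /orP[/eqP-> | lt_in]; first exact: pivots_last P.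
apply: le_trans (pivots_step P lt_in); rewrite lerDl.
rewrite divr_ge0 ?mulr_ge0 // ltW //.
- exact: (pivots_upper P lt_in).
- exact: (pivots_lower P lt_in).
- exact: (pivots_gt0 P lt_in).
Qed.

(** * Determinants with a sparse first row or column *)

Lemma det_row0 (R : comNzRingType) (m : nat) (M : 'M[R]_m.+1) :
  (forall j, j != ord0 -> M ord0 j = 0) ->
  \det M = M ord0 ord0 * \det (row' ord0 (col' ord0 M)).
Proof.
move=> M0; rewrite (expand_det_row _ ord0) (bigD1 ord0) //= big1 => [|j /M0 ->].
  by rewrite addr0 /cofactor addn0 expr0 mul1r.
by rewrite mul0r.
Qed.

Lemma det_col0 (R : comNzRingType) (m : nat) (M : 'M[R]_m.+1) :
  (forall i, i != ord0 -> M i ord0 = 0) ->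
  \det M = M ord0 ord0 * \det (row' ord0 (col' ord0 M)).
Proof.
move=> M0; rewrite -det_tr det_row0 => [|j /M0]; last by rewrite mxE.
by rewrite mxE -det_tr; congr (_ * \det _); apply/matrixP=> i j; rewrite !mxE.
Qed.

(** The recurrence of continuants. Only the first row and column have to be sparse, which is what a
    submatrix of a tridiagonal matrix offers. *)
Lemma det_tridiag_rec (R : comNzRingType) (m : nat) (M : 'M[R]_m.+2) :
  (forall j : 'I_m.+2, (1 < j)%N -> M ord0 j = 0) ->
  (forall i : 'I_m.+2, (1 < i)%N -> M i ord0 = 0) ->
  \det M = M ord0 ord0 * \det (row' ord0 (col' ord0 M))
    - M ord0 (lift ord0 ord0) * M (lift ord0 ord0) ord0
      * \det (row' ord0 (col' ord0 (row' ord0 (col' ord0 M)))).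
Proof.
move=> Mr Mc; rewrite (expand_det_row _ ord0) !big_ord_recl big1 => [|j _]; last first.
  by rewrite Mr ?mul0r.
rewrite addr0; congr (_ + _); first by rewrite /cofactor addn0 expr0 mul1r.
rewrite /cofactor addn1 expr1 mulN1r mulrN -mulrA; congr (- (_ * _)).
(* With row 0 and column 1 deleted, the first column keeps only its top entry. *)
rewrite det_col0 => [|i i0]; last first.
  rewrite !mxE (_ : lift (lift ord0 ord0) ord0 = ord0); last exact: val_inj.
  by rewrite Mc //; case: i i0 => -[].
congr (_ * _); first by rewrite !mxE; congr (M _ _); apply: val_inj.
congr determinant; apply/matrixP=> i j; rewrite !mxE.
by congr (M _ _); apply: val_inj.
Qed.

(** * Minors of a matrix with pivot bounds *)

Lemma increasing_lift0 {m n : nat} {f : 'I_m.+1 -> 'I_n} :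
  increasing f -> increasing (f \o lift ord0).
Proof. by move=> incf i j ij; apply: incf. Qed.

Lemma increasing_gt0 {m n : nat} {f : 'I_m.+1 -> 'I_n} [i : 'I_m.+1] :
  increasing f -> i != ord0 -> (f ord0 < f i)%N.
Proof. by move=> incf i0; apply: incf; rewrite lt0n; exact: i0. Qed.

Lemma increasing_gt1 {m n : nat} {f : 'I_m.+2 -> 'I_n} [i : 'I_m.+2] :
  increasing f -> (1 < i)%N -> ((f ord0).+1 < f i)%N.
Proof.
move=> incf i1; apply: leq_ltn_trans (incf (lift ord0 ord0) i i1).
exact: incf.
Qed.

Section Minors.

Context {R : realFieldType} {n : nat} {a : nat -> nat -> R} {p : nat -> R}.
Hypothesis P : pivots n a p.

Let A : 'M[R]_n.+1 := \matrix_(i, j) a i j.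

Lemma pivots_ge0 (i j : nat) : (i <= n)%N -> (j <= n)%N -> 0 <= a i j.
Proof.
move=> i_n j_n; have [/eqP ->|d0] := boolP (i == j).
  by rewrite (le_trans _ (pivots_le_diag P j_n)) // ltW // (pivots_gt0 P).
have [/eqP e|d1] := boolP (j == i.+1).
  by rewrite e ltW // (pivots_upper P) //; lia.
have [/eqP e|d2] := boolP (i == j.+1).
  by rewrite e ltW // (pivots_lower P) //; lia.
by rewrite (pivots_tridiag P) //; lia.
Qed.

(* The second clause makes the induction go through: deleting a common first
   index costs at most its pivot. *)
Lemma minor_ge_pivot (m : nat) :
  (forall f g : 'I_m -> 'I_n.+1, increasing f -> increasing g ->
     0 <= \det (mxsub f g A)) /\
  (forall f g : 'I_m.+1 -> 'I_n.+1, increasing f -> increasing g ->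
     f ord0 = g ord0 ->
     p (f ord0) * \det (mxsub (f \o lift ord0) (g \o lift ord0) A)
       <= \det (mxsub f g A)).
Proof.
have sub (k : nat) (f g : 'I_k.+1 -> 'I_n.+1) :
    row' ord0 (col' ord0 (mxsub f g A)) = mxsub (f \o lift ord0) (g \o lift ord0) A.
  by apply/matrixP=> i j; rewrite !mxE.
elim: m => [|m [IH0 IHp]].
  split=> [f g _ _|f g _ _ fg]; first by rewrite det_mx00.
  by rewrite det_mx00 mulr1 det_mx11 !mxE -fg; apply: (pivots_le_diag P); rewrite -ltnS.
have ge0 (f g : 'I_m.+1 -> 'I_n.+1) : increasing f -> increasing g ->
    0 <= \det (mxsub f g A).
  move=> incf incg.
  have rest := IH0 _ _ (increasing_lift0 incf) (increasing_lift0 incg).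
  (* If [f ord0 < g ord0], all later column indices are at least [f ord0 + 2], so the first row has
     no other nonzero entry; the opposite case is the same for the first column. *)
  have [fg|gf|/val_inj fg] := ltngtP (f ord0) (g ord0).
  - rewrite det_row0 => [|j j0].
      by rewrite sub mulr_ge0 // !mxE pivots_ge0 // -ltnS.
    have := increasing_gt0 incg j0.
    by rewrite !mxE => gj; rewrite (pivots_tridiag P) //; lia.
  - rewrite det_col0 => [|j j0].
      by rewrite sub mulr_ge0 // !mxE pivots_ge0 // -ltnS.
    have := increasing_gt0 incf j0.
    by rewrite !mxE => fj; rewrite (pivots_tridiag P) //; lia.
  - apply: le_trans (IHp _ _ incf incg fg).
    by rewrite mulr_ge0 // ltW // (pivots_gt0 P) // -ltnS.
split=> // f g incf incg fg.
have incf' := increasing_lift0 incf; have incg' := increasing_lift0 incg.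
have rest := ge0 _ _ incf' incg'.
have f0n : (f ord0 <= n)%N by rewrite -ltnS.
have le_diag : p (f ord0) * \det (mxsub (f \o lift ord0) (g \o lift ord0) A)
    <= mxsub f g A ord0 ord0 * \det (mxsub (f \o lift ord0) (g \o lift ord0) A).
  by rewrite ler_wpM2r // !mxE -fg (pivots_le_diag P).
(* Unless the second row and column indices are both [f ord0 + 1], the first row or the first column
   vanishes off the diagonal, and [le_diag] concludes. *)
have [/eqP g1|g1] := boolP (g (lift ord0 ord0) == (f ord0).+1 :> nat); last first.
  rewrite [leRHS]det_row0 ?sub // => j j0; rewrite !mxE (pivots_tridiag P) //.
  have : (g ord0 < g (lift ord0 ord0))%N by exact: incg.
  case: (unliftP ord0 j) j0 => [k ->|-> //] _.
  case: (unliftP ord0 k) => [l ->|->]; last by rewrite -fg; lia.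
  have := incg (lift ord0 ord0) (lift ord0 (lift ord0 l)) isT.
  by rewrite -fg; lia.
have [/eqP f1|f1] := boolP (f (lift ord0 ord0) == (f ord0).+1 :> nat); last first.
  rewrite [leRHS]det_col0 ?sub // => j j0; rewrite !mxE (pivots_tridiag P) //.
  have : (f ord0 < f (lift ord0 ord0))%N by exact: incf.
  case: (unliftP ord0 j) j0 => [k ->|-> //] _.
  case: (unliftP ord0 k) => [l ->|->]; last by rewrite -fg; lia.
  have := incf (lift ord0 ord0) (lift ord0 (lift ord0 l)) isT.
  by rewrite -fg; lia.
have f1n : (f ord0 < n)%N by rewrite -ltnS -f1.
rewrite [leRHS]det_tridiag_rec => [|j j1|j j1].
- rewrite !sub.
  have /= := IHp _ _ incf' incg' (val_inj (etrans f1 (esym g1))).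
  rewrite !mxE g1 f1 -fg.
  move: rest; set D := \det _; set D' := \det _ => D0 pD.
  (* With [i] for [f ord0], the bound [p i.+1 * D' <= D] makes the subtracted term at most
     [off * D], and [pivots_step] leaves at least [p i * D]. *)
  have p1 := pivots_gt0 P f1n.
  have off : 0 <= a (f ord0) (f ord0).+1 * a (f ord0).+1 (f ord0) / p (f ord0).+1.
    by rewrite divr_ge0 ?mulr_ge0 ?pivots_ge0 // ltW.
  have := ler_wpM2l off pD; rewrite mulrA divfK ?gt_eqF //.
  have := ler_wpM2r D0 (pivots_step P f1n).
  rewrite mulrDl; lra.
- by have := increasing_gt1 incg j1; rewrite !mxE => ?; rewrite (pivots_tridiag P) // fg; lia.
- by have := increasing_gt1 incf j1; rewrite !mxE => ?; rewrite (pivots_tridiag P) // -fg; lia.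
Qed.

Lemma pivots_totally_nonneg : totally_nonneg A.
Proof. by move=> m f g _ incf incg; have [+ _] := minor_ge_pivot m; apply. Qed.

Lemma pivots_principal_minors_pos : principal_minors_pos A.
Proof.
move=> m f _; elim: m f => [|m IH] f incf; first by rewrite det_mx00.
have [_ /(_ f f incf incf erefl)] := minor_ge_pivot m.
apply: lt_le_trans; rewrite mulr_gt0 //; last exact/IH/increasing_lift0.
by rewrite (pivots_gt0 P) // -ltnS.
Qed.

End Minors.

(** * Quadratic forms and definiteness *)

Lemma tridiag_form_recr {R : comNzRingType} {n : nat} {s : nat -> nat -> R}
    (y : nat -> R) :
  (forall i j, s i j = s j i) ->
  (forall i j, (i.+1 < j)%N -> s i j = 0) ->
  \sum_(i < n.+2) \sum_(j < n.+2) y i * s i j * y j =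
  \sum_(i < n.+1) \sum_(j < n.+1) y i * s i j * y j
    + 2 * (y n * s n n.+1 * y n.+1) + y n.+1 * s n.+1 n.+1 * y n.+1.
Proof.
move=> sC s0.
have last_col : \sum_(i < n.+1) y i * s i n.+1 * y n.+1 = y n * s n n.+1 * y n.+1.
  rewrite big_ord_recr big1 /= ?add0r // => i _.
  by rewrite s0 ?mulr0 ?mul0r // ltnS.
have last_row : \sum_(j < n.+1) y n.+1 * s n.+1 j * y j = y n * s n n.+1 * y n.+1.
  by rewrite -last_col; apply: eq_bigr => j _; rewrite sC; ring.
rewrite [LHS]big_ord_recr [X in _ + X = _]big_ord_recr /= last_row.
under eq_bigr => i _ do rewrite big_ord_recr /=.
by rewrite big_split /= last_col; ring.
Qed.

(* Completing the square in [y n.+1], adjoining row [n.+1] costs the form at most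
   [s n n.+1 ^+ 2 / e n.+1 * y n ^+ 2], which the slack [s n n - e n] covers. *)
Lemma tridiag_form_gt {R : realFieldType} {n : nat} {s : nat -> nat -> R}
    {e y : nat -> R} :
  (forall i j, s i j = s j i) ->
  (forall i j, (i.+1 < j)%N -> s i j = 0) ->
  (forall i, (i <= n)%N -> 0 < e i) ->
  (forall i, (i < n)%N -> e i + s i i.+1 ^+ 2 / e i.+1 <= s i i) ->
  (exists2 i, (i <= n)%N & y i != 0) ->
  (s n n - e n) * y n ^+ 2 < \sum_(i < n.+1) \sum_(j < n.+1) y i * s i j * y j.
Proof.
move=> sC s0; elim: n => [|n IH] e0 step [i i_n yi].
  move: i_n yi; rewrite leqn0 => /eqP-> y0; rewrite !big_ord1 /=.
  have : 0 < e 0%N * y 0%N ^+ 2 by rewrite mulr_gt0 ?e0 // exprn_even_gt0.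
  by rewrite expr2; lra.
rewrite tridiag_form_recr //.
have en := e0 n.+1 (leqnn _); have := step n (ltnSn _).
set c := s n n.+1; set d := s n.+1 n.+1 => stepn.
have sq : 0 <= e n.+1 * (y n.+1 + c / e n.+1 * y n) ^+ 2.
  by rewrite mulr_ge0 ?sqr_ge0 // ltW.
have {sq} : 0 <= c ^+ 2 / e n.+1 * y n ^+ 2 + 2 * (y n * c * y n.+1)
                 + e n.+1 * y n.+1 ^+ 2.
  suff -> : c ^+ 2 / e n.+1 * y n ^+ 2 + 2 * (y n * c * y n.+1)
            + e n.+1 * y n.+1 ^+ 2
          = e n.+1 * (y n.+1 + c / e n.+1 * y n) ^+ 2 by [].
  by field; rewrite gt_eqF.
have ynn := sqr_ge0 (y n).
have := ler_wpM2r ynn stepn; rewrite mulrDl.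
(* Strictness comes from the induction hypothesis if some earlier coordinate is nonzero, and
   otherwise from the last square alone. *)
have [/existsP[k yk]|/existsPn y0] := boolP [exists k : 'I_n.+1, y k != 0].
  have := IH (fun i i_n => e0 i (leqW i_n)) (fun i i_n => step i (leqW i_n))
    (ex_intro2 _ _ (val k) (leq_ord k) yk).
  by rewrite !expr2; lra.
have yk k : (k <= n)%N -> y k = 0.
  by rewrite -ltnS => kn; apply/eqP; have := y0 (Ordinal kn); rewrite negbK.
have yn1 : 0 < e n.+1 * y n.+1 ^+ 2.
  rewrite mulr_gt0 // exprn_even_gt0 //=.
  move: i_n yi; rewrite leq_eqVlt => /orP[/eqP<- //|].
  by rewrite ltnS => /yk ->; rewrite eqxx.
rewrite [\sum_(i < _) _]big1 => [|k _]; last first.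
  by rewrite big1 // => j _; rewrite yk ?leq_ord // !mul0r.
rewrite (yk n (leqnn n)); move: yn1; rewrite !expr2; lra.
Qed.

Lemma pivots_posdef {R : realFieldType} {n : nat} {a : nat -> nat -> R}
    {p : nat -> R} :
  pivots n a p -> posdef (\matrix_(i < n.+1, j < n.+1) a i j).
Proof.
move=> P.
(* The weights solve [w k.+1 * a k.+1 k = w k * a k k.+1], which symmetrizes the matrix. *)
pose w := fix w k := if k is k'.+1 then w k' * a k' k'.+1 / a k'.+1 k' else 1.
have w_gt0 k : (k <= n)%N -> 0 < w k.
  elim: k => [|k IH] kn //=.
  by rewrite divr_gt0 ?mulr_gt0 ?IH ?(pivots_upper P) ?(pivots_lower P) // ltnW.
have w_sym k : (k < n)%N -> w k.+1 * a k.+1 k = w k * a k k.+1.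
  by move=> kn /=; rewrite divfK // gt_eqF // (pivots_lower P).
(* The cut at [n] makes [s] symmetric for all indices; [a] has no controlled off-diagonal ratio
   beyond [n]. *)
pose s i j := if (i <= n)%N && (j <= n)%N then w i * a i j else 0.
have sC i j : s i j = s j i.
  rewrite /s andbC; case: ifP => // /andP[jn i_n].
  have [/eqP->//|d0] := boolP (i == j).
  have [/eqP e|d1] := boolP (j == i.+1); first by subst j; rewrite w_sym.
  have [/eqP e|d2] := boolP (i == j.+1); first by subst i; rewrite w_sym.
  by rewrite !(pivots_tridiag P) ?mulr0 //; lia.
have s0 i j : (i.+1 < j)%N -> s i j = 0.
  by move=> ij; rewrite /s (pivots_tridiag P) ?ij // mulr0 if_same.
have sE (i j : 'I_n.+1) : s i j = w i * a i j by rewrite /s !leq_ord.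
have SE (i j : 'I_n.+1) :
    (diag_mx (\row_i w i) *m \matrix_(i < n.+1, j < n.+1) a i j) i j = s i j.
  by rewrite mul_diag_mx !mxE sE.
exists (\row_i w i); split=> [i|]; first by rewrite mxE w_gt0 // leq_ord.
split=> [|x x0]; first by apply/matrixP=> i j; rewrite mxE !SE sC.
pose y i := x (inord i) 0.
have yE (i : 'I_n.+1) : x i 0 = y i by rewrite /y inord_val.
have -> : (x^T *m (diag_mx (\row_i w i) *m \matrix_(i, j) a i j) *m x) 0 0
    = \sum_(i < n.+1) \sum_(j < n.+1) y i * s i j * y j.
  rewrite -mulmxA mxE; apply: eq_bigr => i _.
  rewrite !mxE big_distrr; apply: eq_bigr => j _ /=.
  by rewrite SE !yE mulrA.
have ynz : exists2 i, (i <= n)%N & y i != 0.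
  have [i xi] : exists i, x i 0 != 0.
    apply/existsP; apply: contraNT x0 => /existsPn x0.
    by apply/eqP/colP=> i; rewrite mxE; apply/eqP; have := x0 i; rewrite negbK.
  by exists i; rewrite ?leq_ord // -yE.
(* Row scaling turns the pivot bounds into [w i * p i]: by the choice of [w],
   [s i i.+1 ^+ 2 / w i.+1] equals [w i * a i i.+1 * a i.+1 i]. *)
apply: le_lt_trans (tridiag_form_gt (e := fun i => w i * p i) sC s0 _ _ ynz).
- rewrite /s leqnn /= -mulrBr mulr_ge0 ?sqr_ge0 //.
  by apply: mulr_ge0; [rewrite ltW ?w_gt0 | rewrite subr_ge0 (pivots_last P)].
- by move=> i i_n; rewrite mulr_gt0 ?w_gt0 ?(pivots_gt0 P).
- move=> i i_n; rewrite /s (ltnW i_n) i_n /=.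
  apply: le_trans (ler_wpM2l (ltW (w_gt0 _ (ltnW i_n))) (pivots_step P i_n)).
  rewrite mulrDr lerD2l le_eqVlt; apply/orP; left; apply/eqP => /=.
  have := pivots_gt0 P i_n; have := pivots_upper P i_n.
  have := pivots_lower P i_n; have := w_gt0 _ (ltnW i_n).
  by move=> w0 l0 u0 p0; field; rewrite !gt_eqF.
Qed.

(** * Pivot bounds for the compact scheme *)

(* [edge_gap h k ^+ 2] is the product of the two off-diagonal entries coupling
   the interior rows k - 1 and k of [compact_entry]. *)
Definition edge_gap {R : realFieldType} (h : nat -> R) (k : nat) : R :=
  4 * (h k.-1 * h k.+1) / ((h k.-1 + h k) * (h k + h k.+1)).

(** Over the common denominator all negative terms cancel. This inequality is what makes
    [edge_gap h k] admissible as a pivot bound in the interior. *)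
Lemma edge_gapD_lt4 {R : realFieldType} {h : nat -> R} {k : nat} :
  0 < h k.-1 -> 0 < h k -> 0 < h k.+1 -> 0 < h k.+2 ->
  edge_gap h k + edge_gap h k.+1 < 4.
Proof.
rewrite /edge_gap /=; set a := h k.-1; set b := h k; set c := h k.+1; set d := h k.+2.
move=> a0 b0 c0 d0.
rewrite -subr_gt0.
have -> : 4 - (4 * (a * c) / ((a + b) * (b + c)) + 4 * (b * d) / ((b + c) * (c + d)))
  = 4 * (b * c * (a + b + c + d)) / ((a + b) * (b + c) * (c + d)).
  by field; rewrite !gt_eqF ?addr_gt0.
by rewrite divr_gt0 ?mulr_gt0 ?addr_gt0.
Qed.

Section CompactPivots.

Context {R : realFieldType} {n : nat} {h : nat -> R}.
Hypothesis n4 : (4 <= n)%N.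
Hypothesis h_gt0 : forall k, (1 <= k <= n)%N -> 0 < h k.

Let a := compact_entry n h.
Let g := edge_gap h.

Lemma compact_lower (k : nat) : (1 <= k < n)%N ->
  a k k.-1 = 4 * h k.+1 ^+ 2 / (h k + h k.+1) ^+ 2.
Proof. by case: k => // k kn; rewrite /a /compact_entry /= eqxx ifF //; lia. Qed.

Lemma compact_diag (k : nat) : (1 <= k < n)%N -> a k k = 4.
Proof.
by case: k => // k kn; rewrite /a /compact_entry /= eqxx /= !ifF //; lia.
Qed.

Lemma compact_upper (k : nat) : (1 <= k < n)%N ->
  a k k.+1 = 4 * h k ^+ 2 / (h k + h k.+1) ^+ 2.
Proof.
by case: k => // k kn; rewrite /a /compact_entry /= eqxx /= !ifF //; lia.
Qed.

Lemma compact_last_lower : a n n.-1 = 1.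
Proof. by rewrite /a /compact_entry !eqxx /= ifF //; lia. Qed.

Lemma compact_last_diag : a n n =
  h n.-1 * (h n.-2 + h n.-1) / ((h n.-1 + h n) * (h n.-2 + h n.-1 + h n)).
Proof. by rewrite /a /compact_entry !eqxx /= !ifF //; lia. Qed.

Lemma compact_tridiag (i j : nat) : (i.+1 < j)%N || (j.+1 < i)%N -> a i j = 0.
Proof.
move=> ij; rewrite /a /compact_entry.
by case: ifP => i0; [|case: ifP => i_n]; rewrite !ifF //; lia.
Qed.

Lemma compact_upper_gt0 (k : nat) : (k < n)%N -> 0 < a k k.+1.
Proof.
case: k => [|k] kn; first exact: ltr01.
by rewrite compact_upper // divr_gt0 ?mulr_gt0 ?exprn_gt0 ?addr_gt0 ?h_gt0 //; lia.
Qed.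

Lemma compact_lower_gt0 (k : nat) : (k < n)%N -> 0 < a k.+1 k.
Proof.
rewrite leq_eqVlt => /orP[/eqP kn|kn].
  have ek : k = n.-1 by lia.
  by rewrite kn ek compact_last_lower ltr01.
rewrite (compact_lower k.+1) //.
by rewrite divr_gt0 ?mulr_gt0 ?exprn_gt0 ?addr_gt0 ?h_gt0 //; lia.
Qed.

Lemma edge_gap_gt0 (k : nat) : (2 <= k < n)%N -> 0 < g k.
Proof.
by move=> kn; rewrite /g divr_gt0 ?mulr_gt0 ?addr_gt0 ?h_gt0 //; lia.
Qed.

Lemma compact_coupling (k : nat) : (1 <= k < n.-1)%N ->
  a k k.+1 * a k.+1 k = g k.+1 ^+ 2.
Proof.
move=> kn; rewrite compact_upper ?(compact_lower k.+1) /g /edge_gap /=; try lia.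
have h0 : 0 < h k by apply: h_gt0; lia.
have h1 : 0 < h k.+1 by apply: h_gt0; lia.
have h2 : 0 < h k.+2 by apply: h_gt0; lia.
by field; rewrite !gt_eqF ?addr_gt0.
Qed.

(** Makes positivity of the pivot of row 0 equivalent to the pivot of row 1 exceeding [4 - g 2]. *)
Lemma compact_first_edge : a 0%N 0%N * (4 - g 2) = a 1%N 0%N.
Proof.
rewrite (compact_lower 1) /a /compact_entry /g /edge_gap /=; try lia.
have h1 : 0 < h 1 by apply: h_gt0; lia.
have h2 : 0 < h 2 by apply: h_gt0; lia.
have h3 : 0 < h 3 by apply: h_gt0; lia.
by field; rewrite !gt_eqF ?addr_gt0.
Qed.

(** Eliminating row [n] leaves exactly [g n.-1] as pivot of row [n.-1]; the bounds [g k] start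
    here. *)
Lemma compact_last_edge : g n.-1 + a n.-1 n * a n n.-1 / a n n = 4.
Proof.
rewrite compact_last_diag compact_last_lower.
have := compact_upper n.-1; rewrite /g /edge_gap.
have -> : n.-1.+1 = n by lia.
move=> ->; last by lia.
have h1 : 0 < h n by apply: h_gt0; lia.
have h2 : 0 < h n.-1 by apply: h_gt0; lia.
have h3 : 0 < h n.-2 by apply: h_gt0; lia.
by field; rewrite !gt_eqF ?mulr_gt0 ?addr_gt0.
Qed.

Lemma compact_pivots : exists p, pivots n a p.
Proof.
pose p2 := 4 - g 3; pose p1 := 4 - g 2 ^+ 2 / p2.
pose p0 := a 0%N 0%N - a 1%N 0%N / p1.
(* The default value [g k] of [nth] serves the rows from 3 to [n.-1]. *)
pose p k := if k == n then a n n else nth (g k) [:: p0; p1; p2] k.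
have pn : p n = a n n by rewrite /p eqxx.
have pg k : (3 <= k < n)%N -> p k = g k.
  by case: k => [|[|[|k]]] // kn; rewrite /p ifF /= ?nth_nil //; lia.
have [pE0 pE1 pE2] : [/\ p 0%N = p0, p 1%N = p1 & p 2%N = p2].
  by split; rewrite /p ifF //; lia.
have g2 : 0 < g 2 by apply: edge_gap_gt0; lia.
have g3 : 0 < g 3 by apply: edge_gap_gt0; lia.
have g23 : g 2 < p2.
  by rewrite /p2 ltrBrDr; apply: edge_gapD_lt4; apply: h_gt0; lia.
have p2_gt0 : 0 < p2 by apply: lt_trans g23.
have lt_p1 : 4 - g 2 < p1.
  by rewrite /p1 ltrD2l ltrN2 ltr_pdivrMr // expr2 ltr_pM2l.
have g2_lt4 : g 2 < 4 by move: g23; rewrite /p2; lra.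
have p1_gt0 : 0 < p1 by move: lt_p1; lra.
have a00 : 0 < a 0%N 0%N.
  by rewrite /a /compact_entry /= divr_gt0 ?mulr_gt0 ?addr_gt0 ?h_gt0 //; lia.
have p0_gt0 : 0 < p0.
  by rewrite /p0 subr_gt0 ltr_pdivrMr // -compact_first_edge ltr_pM2l.
exists p; split.
- exact: compact_tridiag.
- exact: compact_upper_gt0.
- exact: compact_lower_gt0.
- move=> k; rewrite leq_eqVlt => /orP[/eqP->|].
    rewrite pn compact_last_diag.
    by rewrite divr_gt0 ?mulr_gt0 ?addr_gt0 ?h_gt0 //; lia.
  case: k => [|[|[|k]]] kn; rewrite ?pE0 ?pE1 ?pE2 //.
  by rewrite pg // edge_gap_gt0.
- by rewrite pn.
have step_last : g n.-1 + a n.-1 n * a n n.-1 / p n = 4.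
  by rewrite pn compact_last_edge.
(* Rows 0, 1 and 2 hold with equality by the choice of [p0], [p1] and [p2]. *)
case=> [|[|[|k]]] kn.
- rewrite pE0 pE1 /p0 [a 0%N 1%N](_ : _ = 1) // mul1r; lra.
- rewrite compact_coupling ?compact_diag ?pE1 ?pE2 /p1 //; last by lia.
  by lra.
- rewrite compact_coupling ?compact_diag ?pE2 ?pg //; try lia.
  by rewrite /p2 expr2 mulfK ?gt_eqF // subrK.
- rewrite compact_diag // pg //.
  (* Row [n.-1] meets the last edge with equality; in the other rows the quotient collapses to
     [g k.+4]. *)
  have [e|kn1] := eqVneq k.+4 n.
    by rewrite -[in leRHS]step_last -e.
  rewrite compact_coupling ?pg; try lia.
  rewrite expr2 mulfK ?gt_eqF ?edge_gap_gt0; try lia.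
  by apply/ltW/edge_gapD_lt4; apply: h_gt0; lia.
Qed.

End CompactPivots.

(** Each entry is a constant or a quotient of quadratic forms in the widths, so a global sign
    cancels and positive widths may be assumed. *)
Lemma compact_entryN (R : realFieldType) (n : nat) (h : nat -> R) (i j : nat) :
  compact_entry n (fun k => - h k) i j = compact_entry n h i j.
Proof. by rewrite /compact_entry -!opprD !mulrNN !sqrrN. Qed.

Theorem theorem4p1 (R : realFieldType) (n : nat) (tau : 'I_n.+1 -> R) :
  (4 <= n)%N ->
  injective tau ->
  same_sign_mesh n (mesh tau) ->
  totally_nonneg (compact_mx tau) /\
  principal_minors_pos (compact_mx tau) /\
  posdef (compact_mx tau).
Proof.
move=> n4 _ same_sign.
have [h [h_gt0 hE]] : exists h, (forall k, (1 <= k <= n)%N -> 0 < h k) /\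
    compact_mx tau = \matrix_(i, j) compact_entry n h i j.
  case: same_sign => [h_gt0|h_lt0]; first by exists (mesh tau).
  exists (fun k => - mesh tau k); split=> [k kn|]; first by rewrite oppr_gt0 h_lt0.
  by apply/matrixP=> i j; rewrite !mxE compact_entryN.
have [p P] := compact_pivots n4 h_gt0.
rewrite hE; split; first exact: pivots_totally_nonneg P.
split; first exact: pivots_principal_minors_pos P.
exact: pivots_posdef P.
Qed.
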